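(* The mapping $S$ defined by $S(w)=Aw\delta$ for $w\in MW(\mathfrak{G})$ is a bijection from $MW(\mathfrak{G})$ to $SD_0(\mathfrak{G})$.
   Context: Let $\mathfrak{G}$ be a complex semisimple Lie algebra of rank $n$, with a fixed Cartan subalgebra, root system $\Delta$, positive roots $\Delta^+$, and simple roots $\alpha_1,\dots,\alpha_n$. Let $A=(a_{ij})$ be the Cartan matrix. Identify $\alpha_i$ with the standard basis vector $e_i$ of $\mathbb{R}^n$, so that $\Delta\subset\mathbb{R}^n$. Equip $\mathbb{R}^n$ with a (positive definite) inner product $\langle\cdot,\cdot\rangle$ such that $2\langle e_i,e_j\rangle/\langle e_i,e_i\rangle=a_{ij}$ for all $i,j$. Let $\delta\in\mathbb{R}^n$ be the half-sum of all positive roots, and $\widetilde{1}=(1,\dots,1)$. $MW(\mathfrak{G})$ denotes the Weyl group of $\mathfrak{G}$ realized as a group of $n\times n$ (integer) matrices with respect to the basis of simple roots, acting on $\mathbb{R}^n$. The primary ellipsoid is $PE(\mathfrak{G})=\{x\in\mathbb{R}^n:\langle x,x-2\delta\rangle=0\}$. For $x\in PE(\mathfrak{G})$ and $i\in\{1,\dots,n\}$, let $h^x_i$ be the (unique) nonzero real number such that $(x_1,\dots,x_i+h^x_i,\dots,x_n)\in PE(\mathfrak{G})$, if such a number exists, and $h^x_i=0$ otherwise; put $h^x=(h^x_1,\dots,h^x_n)$ (one has $h^x=\widetilde{1}-Ax$). Let $T_i:PE(\mathfrak{G})\to PE(\mathfrak{G})$, $T_i(x)=(x_1,\dots,x_{i-1},x_i+h^x_i,x_{i+1},\dots,x_n)$.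 These are involutions, and $WPE(\mathfrak{G})$ is the group of bijections of $PE(\mathfrak{G})$ generated by $T_1,\dots,T_n$. The main orbit $PD_0(\mathfrak{G})$ is the orbit of the origin $0$ under $WPE(\mathfrak{G})$, and $SD_0(\mathfrak{G})=\{h^x:x\in PD_0(\mathfrak{G})\}$ is the corresponding subset of the secondary ellipsoid. *)

(* Defs.v *)
From HB Require Import structures.
From mathcomp Require Import all_boot all_order all_algebra.
From mathcomp Require Import complex.
From mathcomp Require Import boolp classical_sets functions fsbigop reals.

Set Implicit Arguments.
Unset Strict Implicit.
Unset Printing Implicit Defensive.

Import Order.TTheory GRing.Theory Num.Theory.
Local Open Scope classical_set_scope.
Local Open Scope ring_scope.
Local Open Scope complex_scope.

(* Finite-dimensional Lie algebras over a field. *)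
Record lieAlgebra (K : fieldType) := LieAlgebra {
  lie_vect :> vectType K;
  bracket : lie_vect -> lie_vect -> lie_vect;
  _ : forall y, linear (bracket^~ y);
  _ : forall x, linear (bracket x);
  _ : forall x, bracket x x = 0;
  _ : forall x y z, bracket x (bracket y z) + bracket y (bracket z x)
                    + bracket z (bracket x y) = 0
}.

Notation "⁅ x , y ⁆" := (bracket x y) (at level 0, x, y at level 200).

Section LieTheory.
Variables (K : fieldType) (L : lieAlgebra K).
Implicit Types (U V I H : {vspace L}) (x y : L).

(* By bilinearity, the brackets of basis vectors span all of [U, V]. *)
Definition bracketv U V : {vspace L} :=
  <<[seq ⁅u, v⁆ | u <- vbasis U, v <- vbasis V]>>%VS.

Definition lie_ideal I := forall x y, y \in I -> ⁅x, y⁆ \in I.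

Definition derived_series I k := iter k (fun U => bracketv U U) I.

Definition lie_solvable I := exists k, derived_series I k = 0%VS.

Definition semisimple :=
  forall I, lie_ideal I -> lie_solvable I -> I = 0%VS.

Definition ad_diagonalizable x :=
  exists2 b : seq L, basis_of fullv b &
    forall v, v \in b -> exists c : K, ⁅x, v⁆ = c *: v.

(* Cartan subalgebras of a semisimple Lie algebra over an algebraically closed
   field of characteristic 0: maximal abelian (equivalently, abelian and
   self-centralizing) subalgebras consisting of ad-semisimple elements. *)
Record cartan_subalgebra H : Prop := CartanSubalgebra {
  cartan_abelian : forall x y, x \in H -> y \in H -> ⁅x, y⁆ = 0;
  cartan_maximal : forall x, (forall h, h \in H -> ⁅h, x⁆ = 0) -> x \in H;
  cartan_ad_diag : forall h, h \in H -> ad_diagonalizable h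
}.

Definition dual H := 'Hom(subvs_of H, K^o).

Definition in_root_space H (a : dual H) x :=
  forall h : subvs_of H, ⁅vsval h, x⁆ = a h *: x.

Definition is_root H (a : dual H) :=
  a != 0 /\ exists2 x, x != 0 & in_root_space a x.

(* For a root a, [L_a, L_-a] is a line in H, equal to the set of brackets
   [x, y], and it contains a unique h with a(h) = 2. *)
Definition is_coroot H (a : dual H) (h : subvs_of H) :=
  a h = 2%:R /\
  exists x y, [/\ in_root_space a x, in_root_space (- a) y & vsval h = ⁅x, y⁆].

(* The simple roots determine the positive roots, as those with nonnegative
   coordinates. *)
Record simple_roots H n (alpha : 'I_n -> dual H) : Prop := SimpleRoots {
  simple_basis : basis_of fullv [seq alpha i | i <- enum 'I_n];
  simple_root : forall i, is_root (alpha i);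
  simple_coord : forall b : dual H, is_root b -> exists2 k : 'I_n -> int,
    b = \sum_(i < n) (k i)%:~R *: alpha i &
    (forall i, 0 <= k i) \/ (forall i, k i <= 0)
}.

End LieTheory.

Definition e_ {R : realType} {n} (i : 'I_n) : 'cV[R]_n := delta_mx i 0.

Record innerProduct (R : realType) (n : nat) := InnerProduct {
  ip :> 'cV[R]_n -> 'cV[R]_n -> R;
  ipC : forall x y, ip x y = ip y x;
  ipP : forall z a x y, ip (a *: x + y) z = a * ip x z + ip y z;
  ip_gt0 : forall x, x != 0 -> 0 < ip x x
}.

Section RootsInRn.
Variables (R : realType) (n : nat) (G : lieAlgebra R[i]) (H : {vspace G}).
Variable alpha : 'I_n -> dual H.

Definition Delta : set 'cV[R]_n :=
  [set x | is_root (\sum_(i < n) (x i 0)%:C *: alpha i)].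

Definition Delta_pos : set 'cV[R]_n := Delta `&` [set x | forall i, 0 <= x i 0].

(* The sum over a classical set is the intended one since Delta is finite. *)
Definition delta : 'cV[R]_n := 2^-1 *: \sum_(b \in Delta_pos) b.

(* a_ij = alpha_j(h_i), with h_i the coroot of alpha_i *)
Definition cartan_matrix (A : 'M[R]_n) :=
  forall i, exists2 h : subvs_of H, is_coroot (alpha i) h &
    forall j, (A i j)%:C = alpha j h.

Variable f : innerProduct R n.

Definition reflection (b x : 'cV[R]_n) := x - (2 * f x b / f b b) *: b.

Definition reflection_mx (b : 'cV[R]_n) : 'M[R]_n :=
  \matrix_(i, j) reflection b (e_ j) i 0.

(* The Weyl group, generated by the reflections in all roots, as matrices in
   the basis of simple roots. *)
Inductive MW : set 'M[R]_n :=
  | MW_refl b : Delta b -> MW (reflection_mx b)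
  | MW_one : MW 1%:M
  | MW_mul u v : MW u -> MW v -> MW (u *m v)
  | MW_inv u : MW u -> MW (invmx u).

End RootsInRn.

Section Ellipsoid.
Variables (R : realType) (n : nat) (f : innerProduct R n) (d : 'cV[R]_n).

Definition PE : set 'cV[R]_n := [set x | f x (x - 2 *: d) = 0].

(* xget selects an element of the set if there is one (here it is unique for
   x in PE), and returns 0 if the set is empty. *)
Definition hvec (x : 'cV[R]_n) : 'cV[R]_n :=
  \col_i xget 0 [set t : R | t != 0 /\ PE (x + t *: e_ i)].

Lemma Tmap_subproof i (x : PE) : val x + hvec (val x) i 0 *: e_ i \in PE.
Proof.
rewrite mxE; case: xgetP => [t _ [_ PEt]|_]; first exact: mem_set.
by rewrite scale0r addr0; apply: valP.
Qed.

Definition Tmap i (x : PE) : PE := SigSub (Tmap_subproof i x).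

Lemma origin_subproof : (0 : 'cV[R]_n) \in PE.
Proof.
apply: mem_set; rewrite /PE /=.
by rewrite -[X in f X _ = _](addr0 0) -{1}(scaler0 _ (-1)) ipP mulN1r addNr.
Qed.

Definition origin : PE := SigSub origin_subproof.

(* WPE is the group, under composition, generated by the Tmap i. *)
Inductive WPE : set (PE -> PE) :=
  | WPE_T i : WPE (Tmap i)
  | WPE_id : WPE id
  | WPE_comp g h : WPE g -> WPE h -> WPE (g \o h)
  | WPE_inv g h : WPE g -> cancel g h -> cancel h g -> WPE h.

Definition PD0 : set 'cV[R]_n := [set val (g origin) | g in WPE].

Definition SD0 : set 'cV[R]_n := [set hvec x | x in PD0].

End Ellipsoid.

(* Main.v *)
Require Import Defs.
From mathcomp Require Import all_boot all_order all_algebra.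
From mathcomp Require Import complex ring zify.
From mathcomp Require Import boolp classical_sets cardinality functions fsbigop reals.

Set Implicit Arguments.
Unset Strict Implicit.
Unset Printing Implicit Defensive.

Import Order.TTheory GRing.Theory Num.Theory.
Local Open Scope classical_set_scope.
Local Open Scope ring_scope.
Local Open Scope complex_scope.

(** Put y = delta - x. In this coordinate the nonzero solution t of
    PE (x + t e_i) is t = (A y)_i, so that h^x = A y and T_i becomes the simple
    reflection s_i : y |-> y - (A y)_i e_i ([hvecE], [sub_Tmap]). The origin
    corresponds to y = delta, hence SD_0 is the set of all A w delta, for w in
    the group W generated by the simple reflections ([SD0_words]). As A is
    invertible, being a Gram matrix up to the scaling of its rows, two facts
    remain: W is the whole Weyl group, and delta has trivial stabilizer in W.

    Both are facts about the action of W on the set of roots, and they need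
    that the simple reflections permute the roots ([Delta_reflection]). This is
    where Lie theory enters: the coroot of alpha_i comes with an sl_2-triple,
    and the sl_2-string through a root b contains the mirror image of b
    ([root_string_reflection]). Besides, there are finitely many roots, since
    each is determined by its values at the coroots, which are eigenvalues
    ([Delta_finite]); and the coordinates of a root are integers of the same
    sign.

    - W contains the reflection in any root b ([root_reflection_word]): some
      s_i brings b closer to 0 in the sum of absolute coordinates, unless b is
      a multiple of e_i, so b is W-conjugate to a multiple of a simple root.

    - delta is strictly dominant ([ip_simple_root_sum_gt0]): s_i permutes the
      positive roots that are not multiples of e_i, whence these contribute
      nothing to the product of e_i and delta. The stabilizer in W of a
      strictly dominant vector is trivial ([dominant_regular_stabilizer]), by
      the exchange property of words in the simple reflections
      ([word_exchange]). *)

(** * Root strings in a Lie algebra *)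

Section LieAlgebra.
Variables (K : numFieldType) (L : lieAlgebra K).
Implicit Types u v x y : L.

Lemma bracket_linearr x : linear (bracket x).
Proof. by case: L x. Qed.

Lemma bracket_linearl x : linear (fun u => ⁅u, x⁆).
Proof. by case: L x. Qed.

Lemma bracketxx x : ⁅x, x⁆ = 0.
Proof. by case: L x. Qed.

Lemma bracket_cyclic_sum x y z :
  ⁅x, ⁅y, z⁆⁆ + ⁅y, ⁅z, x⁆⁆ + ⁅z, ⁅x, y⁆⁆ = 0.
Proof. by case: L x y z. Qed.

Lemma bracketDr x u v : ⁅x, u + v⁆ = ⁅x, u⁆ + ⁅x, v⁆.
Proof. by rewrite -[u in LHS]scale1r bracket_linearr scale1r. Qed.

Lemma bracketDl x u v : ⁅u + v, x⁆ = ⁅u, x⁆ + ⁅v, x⁆.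
Proof. by rewrite -[u in LHS]scale1r bracket_linearl scale1r. Qed.

Lemma bracket0r x : ⁅x, 0⁆ = 0.
Proof. by apply: (addrI ⁅x, 0⁆); rewrite -bracketDr !addr0. Qed.

Lemma bracketZr x c v : ⁅x, c *: v⁆ = c *: ⁅x, v⁆.
Proof. by rewrite -[c *: v]addr0 bracket_linearr bracket0r addr0. Qed.

Lemma bracketNr x v : ⁅x, - v⁆ = - ⁅x, v⁆.
Proof. by rewrite -scaleN1r bracketZr scaleN1r. Qed.

Lemma bracketC x y : ⁅y, x⁆ = - ⁅x, y⁆.
Proof.
apply/eqP; rewrite -addr_eq0.
have := bracketxx (x + y).
by rewrite bracketDl !bracketDr !bracketxx add0r addr0 addrC => ->.
Qed.

Lemma bracketZl x c v : ⁅c *: v, x⁆ = c *: ⁅v, x⁆.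
Proof. by rewrite bracketC bracketZr -scalerN -bracketC. Qed.

Lemma bracketNl x v : ⁅- v, x⁆ = - ⁅v, x⁆.
Proof. by rewrite bracketC bracketNr -bracketC. Qed.

Lemma bracket_jacobi x y v : ⁅x, ⁅y, v⁆⁆ = ⁅⁅x, y⁆, v⁆ + ⁅y, ⁅x, v⁆⁆.
Proof.
apply/eqP; rewrite -subr_eq0 opprD addrA addrAC -(bracket_cyclic_sum x y v).
by rewrite (bracketC x v) bracketNr (bracketC ⁅x, y⁆ v).
Qed.

(** Expanding an eigenvector in an eigenbasis shows that its eigenvalue is one
    of those of the basis. *)
Lemma ad_diagonalizable_eigenvalues x : ad_diagonalizable x ->
  exists S : seq K, forall v c, v != 0 -> ⁅x, v⁆ = c *: v -> c \in S.
Proof.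
case=> b bb eigb.
have /fin_all_exists[c cP] (i : 'I_(size b)) :
    exists c : K, ⁅x, b`_i⁆ = c *: b`_i by apply/eigb/mem_nth.
exists (codom c) => v d vn0 xv.
have bt : basis_of fullv (in_tuple b) by [].
have vE := coord_basis bt (memvf v).
have xvE : ⁅x, v⁆ = \sum_i (coord (in_tuple b) i v * c i) *: b`_i.
  rewrite {1}vE (big_morph (bracket x) (bracketDr x) (bracket0r x)).
  by apply: eq_bigr => i _; rewrite bracketZr cP scalerA.
have [i ci] : exists i, coord (in_tuple b) i v != 0.
  apply/existsP; apply: contraNT vn0; rewrite negb_exists => /forallP c0.
  rewrite vE big1 // => i _.
  by have /negPn/eqP-> := c0 i; rewrite scale0r.
apply/codomP; exists i; apply/(mulfI ci).
have := congr1 (coord (in_tuple b) i) xv.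
rewrite xvE linearZ /= coord_sum_free ?(basis_free bt) // => ->.
exact: mulrC.
Qed.

Variable H : {vspace L}.
Implicit Types (a b : dual H) (h : subvs_of H).

Lemma in_root_space_bracket a b x v : in_root_space a x -> in_root_space b v ->
  in_root_space (a + b) ⁅x, v⁆.
Proof.
move=> xa vb h.
by rewrite bracket_jacobi xa vb bracketZr bracketZl add_lfunE scalerDl.
Qed.

Lemma in_root_space_iter a b x v k : in_root_space a x -> in_root_space b v ->
  in_root_space (b + a *+ k) (iter k (bracket x) v).
Proof.
move=> xa vb; elim: k => [|k IHk]; first by rewrite addr0.
by rewrite iterS mulrSr addrA addrC; apply: in_root_space_bracket.
Qed.

Lemma lfunMn a h k : (a *+ k) h = (a h : K) *+ k.
Proof.
by elim: k => [|k IHk]; rewrite ?mulr0n ?lfunE // !mulrS add_lfunE IHk.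
Qed.

Lemma lfunN a h : (- a) h = - (a h : K).
Proof. by rewrite lfunE. Qed.

(** The vectors (ad z)^p v that do not vanish are eigenvectors of ad h for the
    pairwise distinct eigenvalues b(h) + p a(h), of which there are only
    finitely many. *)
Lemma root_string_stops a b h z v : ad_diagonalizable (vsval h) -> a h != 0 ->
  in_root_space a z -> in_root_space b v -> v != 0 ->
  exists2 p, iter p (bracket z) v != 0 & iter p.+1 (bracket z) v = 0.
Proof.
move=> /ad_diagonalizable_eigenvalues[S SP] ah za vb vn0.
have exp : exists p, iter p (bracket z) v == 0.
  apply: contrapT => nex.
  pose w p := b h + (a h : K) *+ p.
  have wS p : w p \in S.
    apply: (SP (iter p (bracket z) v)).
      by apply/negP => z0; apply: nex; exists p.
    by rewrite (in_root_space_iter p za vb) add_lfunE lfunMn.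
  have winj : injective w.
    move=> p q /addrI /eqP; rewrite -!(mulr_natr (a h)).
    by rewrite (inj_eq (mulfI ah)) eqr_nat => /eqP.
  have /uniq_leq_size : uniq [seq w p | p <- iota 0 (size S).+1].
    by rewrite map_inj_uniq // iota_uniq.
  move=> /(_ S); rewrite size_map size_iota ltnn => leS.
  by apply/notF/leS => _ /mapP[p _ ->].
case: (ex_minnP exp) => -[|p] /eqP p0 minp.
  by rewrite (p0 : v = 0) eqxx in vn0.
by exists p => //; apply/negP => /minp; rewrite ltnn.
Qed.

Lemma iter_bracket_eq0 z v k l : (k <= l)%N ->
  iter k (bracket z) v = 0 -> iter l (bracket z) v = 0.
Proof.
move=> /subnK <- v0; rewrite iterD v0.
by elim: (l - k)%N => //= j ->; rewrite bracket0r.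
Qed.

(** The classical sl_2 formula x y^(k+1) u = (k+1) (m - k) y^k u for a vector u
    of weight m killed by x. *)
Lemma bracket_primitive_vector a b h x y u (m : K) k :
    vsval h = ⁅x, y⁆ -> a h = 2 -> in_root_space (- a) y ->
    in_root_space b u -> b h = m -> ⁅x, u⁆ = 0 ->
  ⁅x, iter k.+1 (bracket y) u⁆ =
    (k.+1%:R * (m - k%:R)) *: iter k (bracket y) u.
Proof.
move=> hE ah ya ub bh xu.
elim: k => [|k IHk].
  by rewrite /= bracket_jacobi xu bracket0r addr0 -hE ub bh mul1r subr0.
rewrite iterS bracket_jacobi IHk bracketZr -iterS -hE.
rewrite (in_root_space_iter k.+1 ya ub) add_lfunE lfunMn lfunN ah bh -scalerDl.
congr (_ *: _).
have -> : ((m : K^o) + - 2 *+ k.+1 = m - 2 * k.+1%:R :> K).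
  by rewrite mulNrn mulr_natr.
rewrite -[k.+2%:R]natr1 -!(natr1 k).
ring.
Qed.

(** Climb from v with x as long as possible, in p steps, and from the top go
    down with y, in q steps. By the formula above, the vanishing of the last
    step forces the weight at the top to be q, so that b(h) = q - 2p. The mirror
    image of b in this string lies q - p steps below the top: it is in the
    string if p <= q, in particular when b lies in its upper half. *)
Lemma root_string_reflection a b h x y v :
    vsval h = ⁅x, y⁆ -> a h = 2 -> in_root_space a x -> in_root_space (- a) y ->
    ad_diagonalizable (vsval h) -> in_root_space b v -> v != 0 ->
  exists p q : nat, (b h : K) = q%:R - 2 * p%:R /\
    ((p <= q)%N ->
     exists2 u, u != 0 & in_root_space (b - (b h : K) *: a) u).
Proof.
move=> hE ah xa ya hD vb vn0.
have a2 : a h != 0 by rewrite ah pnatr_eq0.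
have na2 : (- a) h != 0 by rewrite lfunN oppr_eq0.
have [p u0 xu] := root_string_stops hD a2 xa vb vn0.
set u := iter p _ v in u0; have ub := in_root_space_iter p xa vb.
rewrite -/u in ub.
have [q w0 w1] := root_string_stops hD na2 ya ub u0.
have /eqP := bracket_primitive_vector q hE ah ya ub erefl xu.
rewrite w1 bracket0r eq_sym scaler_eq0 (negPf w0) orbF mulf_eq0 pnatr_eq0 /=.
rewrite add_lfunE lfunMn ah subr_eq0 => /eqP bq.
exists p, q; have bE : (b h : K) = q%:R - 2 * p%:R.
  by rewrite -bq mulr_natr addrK.
split=> // le_pq; exists (iter (q - p) (bracket y) u).
  by apply: contraNneq w0 => /(iter_bracket_eq0 (leq_subr p q)) ->.
have := in_root_space_iter (q - p) ya ub.
suff -> : b + a *+ p + (- a) *+ (q - p) = b - (b h : K) *: a by [].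
rewrite bE scalerBl -addrA; congr (_ + _).
rewrite mulrnBr // !mulNrn opprB scaler_nat -natrM scaler_nat mul2n -addnn.
by rewrite mulrnDr opprK addrCA addrA [RHS]addrC addrA.
Qed.

(** If b lies in the lower half of its x-string, it lies in the upper half of
    its string for the opposite triple (y, x, -h). *)
Lemma is_root_reflection a b h x y :
    vsval h = ⁅x, y⁆ -> a h = 2 -> in_root_space a x -> in_root_space (- a) y ->
    ad_diagonalizable (vsval h) -> is_root b ->
  is_root (b - (b h : K) *: a).
Proof.
move=> hE ah xa ya hD [b0 [v vn0 vb]]; split.
  (* If b = b(h) a, evaluation at h gives b(h) = 2 b(h), hence b = 0. *)
  apply: contraNneq b0 => /eqP; rewrite subr_eq0 => /eqP bE.
  have /eqP : (b h : K) = b h * 2 by rewrite {1}bE scale_lfunE ah.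
  rewrite -subr_eq0 -{1}[b h]mulr1 -mulrBr mulf_eq0 => /orP[/eqP bh0|].
    by rewrite bE bh0 scale0r.
  by rewrite (_ : 1 - 2 = -1 :> K) ?oppr_eq0 ?oner_eq0 //; ring.
have [p [q [bhE]]] := root_string_reflection hE ah xa ya hD vb vn0.
case: leqP => [_ /(_ isT)//|lt_qp _].
(* The opposite triple, for the root - a. *)
have hE' : vsval (- h) = ⁅y, x⁆ by rewrite bracketC -hE linearN.
have ah' : (- a) (- h) = 2 by rewrite lfunN linearN opprK.
have xa' : in_root_space (- - a) x by rewrite opprK.
have hD' : ad_diagonalizable (vsval (- h)).
  case: hD => s sb eig; exists s => // w /eig[c hw]; exists (- c).
  by rewrite linearN bracketNl hw scaleNr.
have := root_string_reflection hE' ah' ya xa' hD' vb vn0.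
rewrite linearN scaleNr scalerN opprK => -[p' [q' [bhE']]].
case: leqP => [_ /(_ isT)//|lt_qp' _].
(* Both strings cannot start in their lower half: the two values of b(h) would
   be negative and positive. *)
have /eqP : (q + q')%:R = (2 * (p + p'))%:R :> K.
  apply/eqP; rewrite -subr_eq0 natrM !natrD; apply/eqP.
  by rewrite -(subrr (b h : K)) {1}bhE -[X in _ - X]opprK bhE'; ring.
rewrite eqr_nat => /eqP qE.
by have := leq_add (ltnW lt_qp) lt_qp'; rewrite mul2n -addnn in qE; lia.
Qed.
End LieAlgebra.

(** * Roots in simple coordinates *)

Lemma col_eE (R : realType) n (x : 'cV[R]_n) : x = \sum_i x i 0 *: e_ i.
Proof.
apply/colP => k; rewrite summxE (bigD1 k) //= big1 => [|i ik].
  by rewrite !mxE !eqxx mulr1 addr0.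
by rewrite !mxE eq_sym (negPf ik) mulr0.
Qed.

Section RootCoordinates.
Variables (R : realType) (n : nat) (G : lieAlgebra R[i]) (H : {vspace G}).
Variables (alpha : 'I_n -> dual H) (A : 'M[R]_n).
Hypotheses (cartanH : cartan_subalgebra H) (simple_alpha : simple_roots alpha).
Hypothesis (cartanA : cartan_matrix alpha A).

Definition root_of (x : 'cV[R]_n) : dual H := \sum_i (x i 0)%:C *: alpha i.

Lemma root_ofB x y : root_of (x - y) = root_of x - root_of y.
Proof.
rewrite /root_of -sumrB; apply: eq_bigr => i _.
by rewrite !mxE rmorphB scalerBl.
Qed.

Lemma root_ofZe c i : root_of (c *: e_ i) = c%:C *: alpha i.
Proof.
rewrite /root_of (bigD1 i) //= big1 => [|j ji].
  by rewrite !mxE !eqxx mulr1 addr0.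
by rewrite !mxE (negPf ji) mulr0 scale0r.
Qed.

(** Row i of the Cartan matrix computes the values at the i-th coroot. *)
Lemma root_of_coroot x i h : (forall j, (A i j)%:C = alpha j h) ->
  root_of x h = ((A *m x) i 0)%:C.
Proof.
move=> hA; rewrite /root_of sum_lfunE mxE rmorph_sum; apply: eq_bigr => j _.
by rewrite scale_lfunE -hA /= rmorphM /= mulrC.
Qed.

Lemma simple_roots_inj (c d : 'I_n -> R[i]) :
  \sum_i c i *: alpha i = \sum_i d i *: alpha i -> c =1 d.
Proof.
move=> cd i; apply/eqP; rewrite -subr_eq0; apply/eqP.
have fr := basis_free (simple_basis simple_alpha).
have frt : free [tuple alpha i | i < n] by rewrite /= /image_mem in fr *.
have /freeP/(_ (fun i => c i - d i)) := frt.
apply; rewrite -[RHS](subrr (\sum_i d i *: alpha i)) -{1}cd -sumrB.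
by apply: eq_bigr => j _; rewrite scalerBl -tnth_nth tnth_mktuple.
Qed.

Lemma Delta_neq0 x : Delta alpha x -> x != 0.
Proof.
move=> [x0 _]; apply: contraNneq x0 => ->; apply/eqP.
by rewrite big1 // => i _; rewrite mxE scale0r.
Qed.

Lemma Delta_simple i : Delta alpha (e_ i).
Proof.
by rewrite /Delta /= -/(root_of _) -[e_ i]scale1r root_ofZe scale1r;
  exact: simple_root.
Qed.

Lemma Delta_coord x : Delta alpha x -> exists2 k : 'I_n -> int,
  x = \col_i (k i)%:~R & (forall i, 0 <= k i) \/ (forall i, k i <= 0).
Proof.
move=> /(simple_coord simple_alpha)[k /simple_roots_inj xk sgk].
exists k => //; apply/colP => i; rewrite mxE.
by have [] := xk i; rewrite -(rmorph_int (real_complex R)) => -[].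
Qed.

(** Since x(h_i) = (A x)_i, this is the mirror image of x in its
    alpha_i-string. *)
Lemma Delta_reflection i x :
  Delta alpha x -> Delta alpha (x - (A *m x) i 0 *: e_ i).
Proof.
rewrite /Delta /= -!/(root_of _) root_ofB root_ofZe => rx.
have [h [h2 [u [v [ux vy hE]]]] hA] := cartanA i.
rewrite -(root_of_coroot x hA).
apply: is_root_reflection hE h2 ux vy _ rx.
exact/(cartan_ad_diag cartanH)/subvsP.
Qed.

(** A root x is determined by A x, whose i-th entry is an eigenvalue of the
    i-th coroot. *)
Lemma Delta_finite : A \in unitmx -> finite_set (Delta alpha).
Proof.
move=> Au.
have /fin_all_exists[S SP] (i : 'I_n) : exists S : seq R,
    forall x, Delta alpha x -> (A *m x) i 0 \in S.
  have [h _ hA] := cartanA i.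
  have [S SP] := ad_diagonalizable_eigenvalues
    (cartan_ad_diag cartanH (subvsP h)).
  exists (map (@complex.Re R) S) => x [_ [v vn0 vx]].
  apply/mapP; exists ((A *m x) i 0)%:C => //.
  by apply: SP vn0 _; rewrite vx (root_of_coroot x hA).
pose T := {dffun forall i : 'I_n, seq_sub (S i)}.
pose g (t : T) : 'cV[R]_n := invmx A *m \col_i ssval (t i).
apply: (@sub_finite_set _ _ (g @` setT)); last exact/finite_image/finite_finset.
move=> x Dx; exists [ffun i => SeqSub (SP i x Dx)] => //.
by apply: (canLR (mulKmx Au)); apply/colP => i; rewrite mxE ffunE.
Qed.
End RootCoordinates.

(** * Reflections and words in the simple reflections *)

Section InnerProduct.
Variables (R : realType) (n : nat) (f : innerProduct R n).
Implicit Types (x y b : 'cV[R]_n) (M : 'M[R]_n).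

Lemma ipDl x y b : f (x + y) b = f x b + f y b.
Proof. by rewrite -{1}[x]scale1r ipP mul1r. Qed.

Lemma ip0l b : f 0 b = 0.
Proof. by apply: (addrI (f 0 b)); rewrite -ipDl !addr0. Qed.

Lemma ipZl c x b : f (c *: x) b = c * f x b.
Proof. by rewrite -[c *: x]addr0 ipP ip0l addr0. Qed.

Lemma ipBl x y b : f (x - y) b = f x b - f y b.
Proof. by rewrite ipDl -scaleN1r ipZl mulN1r. Qed.

Lemma ipDr x y b : f b (x + y) = f b x + f b y.
Proof. by rewrite !(ipC f b) ipDl. Qed.

Lemma ipZr c x b : f b (c *: x) = c * f b x.
Proof. by rewrite !(ipC f b) ipZl. Qed.

Lemma ipBr x y b : f b (x - y) = f b x - f b y.
Proof. by rewrite !(ipC f b) ipBl. Qed.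

Lemma ip_suml I (r : seq I) (P : pred I) (F : I -> 'cV[R]_n) b :
  f (\sum_(i <- r | P i) F i) b = \sum_(i <- r | P i) f (F i) b.
Proof. exact: (big_morph (f^~ b) (fun x y => ipDl x y b) (ip0l b)). Qed.

Lemma ip_coordl x y : f x y = \sum_i x i 0 * f (e_ i) y.
Proof. by rewrite {1}(col_eE x) ip_suml; apply: eq_bigr => i _; rewrite ipZl. Qed.

Lemma ip_neq0 x : x != 0 -> f x x != 0.
Proof. by move/(ip_gt0 f)/lt0r_neq0. Qed.

Lemma e_neq0 (i : 'I_n) : e_ i != 0 :> 'cV[R]_n.
Proof. by apply/eqP => /colP/(_ i)/eqP; rewrite !mxE !eqxx oner_eq0. Qed.

Lemma reflection_linear b : linear (reflection f b).
Proof. by move=> c x y; apply/colP => k; rewrite !mxE ipP; ring. Qed.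

Lemma reflection_mxE b x : reflection_mx f b *m x = reflection f b x.
Proof.
have s0 : reflection f b 0 = 0.
  by rewrite /reflection ip0l mulr0 mul0r scale0r subr0.
have sD x1 x2 : reflection f b (x1 + x2) = reflection f b x1 + reflection f b x2.
  by rewrite -[x1 in LHS]scale1r reflection_linear scale1r.
rewrite [in RHS](col_eE x) (big_morph _ sD s0); apply/colP => k.
rewrite summxE mxE; apply: eq_bigr => j _.
by rewrite -[_ *: e_ j]addr0 reflection_linear s0 !mxE addr0 mulrC.
Qed.

Lemma reflection_isometry b x y : b != 0 ->
  f (reflection f b x) (reflection f b y) = f x y.
Proof.
move=> /ip_neq0 bb; rewrite /reflection !ipBl !ipBr !ipZl !ipZr (ipC f b y).
by field.
Qed.

Lemma reflection_self b : b != 0 -> reflection f b b = - b.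
Proof.
move=> /ip_neq0 bb.
by rewrite /reflection mulfK // scaler_nat mulr2n opprD addrA subrr sub0r.
Qed.

Lemma reflectionK b : b != 0 -> involutive (reflection f b).
Proof.
move=> /ip_neq0 bb x; apply/colP => k; rewrite /reflection !mxE ipBl ipZl.
by field.
Qed.

Lemma reflectionZ c b : c != 0 -> reflection f (c *: b) =1 reflection f b.
Proof.
move=> c0 x; have [->|/ip_neq0 bb] := eqVneq b 0; first by rewrite scaler0.
apply/colP => k; rewrite /reflection !mxE !ipZl !ipZr.
by field; rewrite c0 bb.
Qed.

Definition ip_preserving M := forall x y, f (M *m x) (M *m y) = f x y.

Lemma reflection_isometric M b x : ip_preserving M ->
  reflection f (M *m b) (M *m x) = M *m reflection f b x.
Proof. by move=> iM; rewrite /reflection !iM mulmxBr -scalemxAr. Qed.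

Lemma eq_mulmx_col (M N : 'M[R]_n) :
  (forall x : 'cV[R]_n, M *m x = N *m x) -> M = N.
Proof.
move=> MN; apply/matrixP => i j.
by have /colP/(_ i) := MN (delta_mx j 0); rewrite -!colE !mxE.
Qed.

(** An isometry M carries the reflection in b to the reflection in M b. *)
Lemma reflection_mx_conj M b : ip_preserving M ->
  reflection_mx f (M *m b) *m M = M *m reflection_mx f b.
Proof.
move=> iM; apply: eq_mulmx_col => x.
by rewrite -!mulmxA !reflection_mxE reflection_isometric.
Qed.

Lemma reflection_mxZ c b : c != 0 -> reflection_mx f (c *: b) = reflection_mx f b.
Proof.
by move=> c0; apply: eq_mulmx_col => x; rewrite !reflection_mxE reflectionZ.
Qed.

Lemma reflection_mxK b : b != 0 -> reflection_mx f b *m reflection_mx f b = 1%:M.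
Proof.
move=> b0; apply: eq_mulmx_col => x.
by rewrite -mulmxA !reflection_mxE reflectionK // mul1mx.
Qed.

Lemma simple_reflection_coord i j x : j != i ->
  (reflection f (e_ i) x) j 0 = x j 0.
Proof. by move=> ji; rewrite !mxE (negPf ji) mulr0 subr0. Qed.

(** The group generated by the simple reflections is represented by words, for
    the sake of induction on their length. *)
Definition word_mx (s : seq 'I_n) : 'M[R]_n :=
  foldr (fun i M => reflection_mx f (e_ i) *m M) 1%:M s.

Lemma word_mx_cat s t : word_mx (s ++ t) = word_mx s *m word_mx t.
Proof. by elim: s => [|i s IHs] /=; rewrite ?mul1mx // IHs mulmxA. Qed.

Lemma word_mx1 i : word_mx [:: i] = reflection_mx f (e_ i).
Proof. exact: mulmx1. Qed.

Lemma word_mx_isometry s : ip_preserving (word_mx s).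
Proof.
elim: s => [|i s IHs] x y /=; first by rewrite !mul1mx.
by rewrite -!mulmxA !reflection_mxE reflection_isometry ?e_neq0.
Qed.

Lemma word_mx_revK s : word_mx (rev s) *m word_mx s = 1%:M.
Proof.
elim: s => [|i s IHs] /=; first exact: mulmx1.
rewrite rev_cons -cats1 word_mx_cat word_mx1 -mulmxA (mulmxA (reflection_mx _ _)).
by rewrite reflection_mxK ?e_neq0 // mul1mx.
Qed.
End InnerProduct.

(** * Finite root sets stable under the simple reflections *)

Section SimpleReflections.
Variables (R : realType) (n : nat) (f : innerProduct R n) (D : set 'cV[R]_n).
Implicit Types (x b : 'cV[R]_n) (s : seq 'I_n).

Definition nonneg_col : set 'cV[R]_n := [set x | forall i, 0 <= x i 0].
Definition nonpos_col : set 'cV[R]_n := [set x | forall i, x i 0 <= 0].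

Hypotheses (D_finite : finite_set D) (D_neq0 : forall x, D x -> x != 0).
Hypothesis (D_simple : forall i, D (e_ i)).
Hypothesis (D_coord : forall x, D x -> exists2 k : 'I_n -> int,
  x = \col_i (k i)%:~R & (forall i, 0 <= k i) \/ (forall i, k i <= 0)).
Hypothesis (D_reflection : forall i x, D x -> D (reflection f (e_ i) x)).

Lemma D_sign x : D x -> nonneg_col x \/ nonpos_col x.
Proof.
move=> /D_coord[k -> [k0|k0]]; [left|right] => i /=.
  by rewrite mxE ler0z.
by rewrite mxE lerz0.
Qed.

Lemma D_word s x : D x -> D (word_mx f s *m x).
Proof.
elim: s => [|i s IHs] Dx /=; first by rewrite mul1mx.
by rewrite -mulmxA reflection_mxE; apply/D_reflection/IHs.
Qed.

(** A simple reflection s_i changes the i-th coordinate only, so a positive root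
    made negative has all its other coordinates equal to 0. *)
Lemma sign_change_simple i x : D x -> nonneg_col x ->
  nonpos_col (reflection f (e_ i) x) -> exists2 c, 0 < c & x = c *: e_ i.
Proof.
move=> Dx xp xn; have xE : x = x i 0 *: e_ i.
  apply/colP => j; have [->|ji] := eqVneq j i.
    by rewrite !mxE !eqxx mulr1.
  rewrite !mxE (negPf ji) mulr0; apply/eqP; rewrite eq_le xp andbT.
  by rewrite -(simple_reflection_coord f x ji) xn.
exists (x i 0) => //; rewrite lt0r xp andbT.
by apply: contraNneq (D_neq0 Dx) => xi0; rewrite xE xi0 scale0r.
Qed.

(** By induction on the sum of the absolute values of the coordinates of b.
    As f b b > 0, some coordinate b_i has the sign of f e_i b; then s_i moves it
    towards 0. If b and s_i b have the same sign, the induction applies to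
    s_i b; if not, b is a multiple of e_i. *)
Lemma root_reflection_word b : D b -> exists s, reflection_mx f b = word_mx f s.
Proof.
move=> Db; have [k bE _] := D_coord Db.
have [N] := ubnP (\sum_j absz (k j)).
elim: N b k Db bE => // N IHN b k Db bE leN.
have [i bi] : exists i, 0 < b i 0 * f (e_ i) b.
  apply/existsP; have := ip_gt0 f (D_neq0 Db); apply: contraTT.
  rewrite negb_exists => /forallP le0; rewrite -leNgt ip_coordl.
  by apply: sumr_le0 => i _; rewrite leNgt.
set y := reflection f (e_ i) b; have Dy : D y by apply: D_reflection.
have ei0 : e_ i != 0 :> 'cV[R]_n by apply: e_neq0.
have bK : b = reflection f (e_ i) y by rewrite reflectionK.
have yiE : y i 0 = b i 0 - 2 * f (e_ i) b / f (e_ i) (e_ i).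
  by rewrite /y !mxE !eqxx mulr1 (ipC f b).
have eei : 0 < f (e_ i) (e_ i) by apply: ip_gt0.
have [yi_lt|[c c0 bc]] : `|y i 0| < `|b i 0| \/
    exists2 c, c != 0 & b = c *: e_ i.
- case: (D_sign Db) (D_sign Dy) => bs [] ys.
  + left; have feb : 0 < f (e_ i) b.
      have := bs i; rewrite le_eqVlt => /orP[/eqP b0|/pmulr_rgt0 <-//].
      by rewrite -b0 mul0r ltxx in bi.
    by rewrite !ger0_norm // yiE ltrBlDr ltrDl divr_gt0 // mulr_gt0.
  + right; have [c c0 ->] := sign_change_simple Db bs ys.
    by exists c; rewrite ?lt0r_neq0.
  + right; rewrite bK in bs; have [c c0 yE] := sign_change_simple Dy ys bs.
    exists (- c); first by rewrite oppr_eq0 lt0r_neq0.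
    by rewrite bK -reflection_mxE yE -scalemxAr reflection_mxE
               reflection_self // scalerN scaleNr.
  + left; have feb : f (e_ i) b < 0.
      have := bs i; rewrite le_eqVlt => /orP[/eqP b0|/nmulr_rgt0 <-//].
      by rewrite b0 mul0r ltxx in bi.
    by rewrite !ler0_norm // yiE ltrN2 ltrBrDr gtrDl nmulr_rlt0 ?invr_gt0 //
               pmulr_rlt0.
- have [l yE _] := D_coord Dy.
  have [s ys] : exists s, reflection_mx f y = word_mx f s.
    apply: (IHN y l Dy yE); rewrite ltnS in leN; apply: leq_trans leN.
    rewrite (bigD1 i) //= [leqRHS](bigD1 i) //=.
    rewrite -addSn leq_add //.
      rewrite yE bE !mxE -!intr_norm ltr_int in yi_lt.
      by rewrite -!abszE ltz_nat in yi_lt.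
    rewrite leq_eqVlt; apply/orP/or_introl/eqP/eq_bigr => j ji; congr absz.
    apply: (@intr_inj R); have := simple_reflection_coord f b ji.
    by rewrite -/y yE {1}bE !mxE.
  exists (i :: s ++ [:: i]); rewrite /= word_mx_cat word_mx1 -ys.
  have iso_i : ip_preserving f (reflection_mx f (e_ i)).
    by rewrite -word_mx1; apply: word_mx_isometry.
  rewrite mulmxA -(reflection_mx_conj _ iso_i) reflection_mxE -bK.
  by rewrite -mulmxA reflection_mxK // mulmx1.
- by exists [:: i]; rewrite bc reflection_mxZ // word_mx1.
Qed.

(** Follow e_i through the letters of s, from the right. As it ends negative,
    some letter j sends a positive root u e_i to a negative one, where u is the
    part of s read so far. Then u e_i is a multiple of e_j, so s_j u = u s_i:
    multiplying by s_i cancels the letter j. *)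
Lemma word_exchange s i : nonpos_col (word_mx f s *m e_ i) ->
  exists2 t, (size t < size s)%N &
    word_mx f s *m reflection_mx f (e_ i) = word_mx f t.
Proof.
elim: s => [|j s IHs] /=.
  by rewrite mul1mx => /(_ i); rewrite !mxE !eqxx ler10.
have Dse : D (word_mx f s *m e_ i) by apply: D_word.
rewrite -mulmxA reflection_mxE => jsn.
case: (D_sign Dse) => [sp|/IHs[t st tE]]; last first.
  by exists (j :: t); rewrite //= -mulmxA tE.
have [c c0 seE] := sign_change_simple Dse sp jsn.
exists s => //; rewrite -(reflection_mxZ f _ (lt0r_neq0 c0)) -seE.
rewrite reflection_mx_conj; last exact: word_mx_isometry.
by rewrite -mulmxA reflection_mxK ?e_neq0 // mulmx1.
Qed.

(** Let w = u s_i fix d. If u e_i is positive, then f (u e_i) d >= 0, whereas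
    f (u e_i) d = f (u e_i) (u s_i d) = f (s_i e_i) d = - f e_i d < 0. So u e_i is
    negative, and the exchange property shortens the word of w. *)
Lemma dominant_regular_stabilizer d s : (forall i, 0 < f (e_ i) d) ->
  word_mx f s *m d = d -> word_mx f s = 1%:M.
Proof.
move=> d_gt0; have [N] := ubnP (size s).
elim: N s => // N IHN s sN sd.
case/lastP: s sN sd => [//|u i]; rewrite size_rcons ltnS -cats1 => uN.
rewrite word_mx_cat word_mx1 => uid.
have De : D (word_mx f u *m e_ i) by apply: D_word.
have [up|/word_exchange[t tu tE]] := D_sign De; last first.
  by rewrite tE; apply: IHN; [apply: ltn_trans tu uN|rewrite -tE].
have : 0 <= f (word_mx f u *m e_ i) d.
  by rewrite ip_coordl sumr_ge0 // => j _; rewrite mulr_ge0 // ltW.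
rewrite -{1}uid -mulmxA reflection_mxE word_mx_isometry.
rewrite -(reflection_isometry f _ _ (e_neq0 R i)) reflectionK ?e_neq0 //.
rewrite reflection_self ?e_neq0 // -scaleN1r ipZl mulN1r oppr_ge0.
by rewrite leNgt d_gt0.
Qed.

(** The positive roots split into the multiples of e_i, which contribute
    positively, and the others. The latter are permuted by s_i, which changes
    the sign of their product with e_i: they contribute 0. *)
Lemma ip_simple_root_sum_gt0 i :
  0 < f (e_ i) (\sum_(b \in D `&` nonneg_col) b).
Proof.
pose P := D `&` nonneg_col; pose B : set 'cV[R]_n :=
  [set x | x = x i 0 *: e_ i :> 'cV[R]_n].
have Pfin : finite_set P by apply: sub_finite_set D_finite => x [].
rewrite -/P.
have ip_fsum Q : finite_set Q ->
    f (e_ i) (\sum_(b \in Q) b) = \sum_(b \in Q) f (e_ i) b.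
  move=> Qfin; rewrite !fsbig_finite // ipC ip_suml.
  by apply: eq_bigr => b _; rewrite ipC.
have rK := reflectionK f (e_neq0 R i).
rewrite ip_fsum // (fsbigID B) //= [X in _ + X](_ : _ = 0).
  rewrite addr0 (fsbigD1 (e_ i)) /=; last 2 first.
  - by apply: sub_finite_set Pfin => x [].
  - split; first by split=> // k; rewrite mxE ler0n.
    by rewrite /B /= mxE !eqxx scale1r.
  rewrite ltr_wpDr ?ip_gt0 ?e_neq0 //.
  apply: fsumr_ge0 => x [[[_ xp] xE] _].
  by rewrite xE ipZr mulr_ge0 // ltW // ip_gt0 // e_neq0.
(* The positive roots outside the line of e_i: their contribution S satisfies
   S = - S. *)
set S := (X in X = 0); have : S = - S; last first.
  by move=> /eqP; rewrite -addr_eq0 -mulr2n mulrn_eq0 => /eqP.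
rewrite -[RHS]mulN1r /S mulr_fsumr.
rewrite (reindex_fsbig (reflection f (e_ i)) (P `&` ~` B)) /=.
  apply: eq_fsbigr => x _.
  by rewrite -{1}(rK (e_ i)) reflection_isometry ?e_neq0 //
             reflection_self ?e_neq0 // -scaleN1r ipZl.
have stab x : (P `&` ~` B) x -> (P `&` ~` B) (reflection f (e_ i) x).
  move=> [[Dx xp] xB]; have Dr := D_reflection i Dx; split.
    split=> //; case: (D_sign Dr) => // xn; case: xB.
    have [c _ xE] := sign_change_simple Dx xp xn.
    by rewrite /B /= xE !mxE !eqxx mulr1.
  apply: contra_not xB; rewrite /B /= => rE.
  set c := _ i 0 in rE; have xE : x = - c *: e_ i.
    rewrite -[LHS]rK rE -reflection_mxE -scalemxAr reflection_mxE.
    by rewrite reflection_self ?e_neq0 // scalerN scaleNr.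
  by rewrite {2}xE !mxE !eqxx mulr1.
split=> //.
- by move=> x y _ _; apply: (can_inj rK).
- by move=> x Px; exists (reflection f (e_ i) x); [apply: stab|apply: rK].
Qed.
End SimpleReflections.

(** * The ellipsoid, centred at delta *)

Section Ellipsoid.
Variables (R : realType) (n : nat) (f : innerProduct R n) (d : 'cV[R]_n).
Variable A : 'M[R]_n.
Hypothesis A_gram :
  forall i j : 'I_n, 2 * f (e_ i) (e_ j) / f (e_ i) (e_ i) = A i j.

Lemma gram_mulmx x i : (A *m x) i 0 = 2 * f x (e_ i) / f (e_ i) (e_ i).
Proof.
rewrite ip_coordl mulr_sumr mulr_suml mxE; apply: eq_bigr => j _.
by rewrite -A_gram (ipC f (e_ j)) mulrC !mulrA (mulrC _ 2).
Qed.

Lemma simple_reflection_gram i x :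
  reflection f (e_ i) x = x - (A *m x) i 0 *: e_ i.
Proof. by rewrite gram_mulmx. Qed.

(** If A v = 0, then v is orthogonal to every e_i, hence to itself. *)
Lemma gram_unitmx : A \in unitmx.
Proof.
rewrite -unitmx_tr -row_free_unit; apply/inj_row_free => v vA.
have {vA} xA : A *m v^T = 0 by rewrite -[A]trmxK -trmx_mul vA trmx0.
apply: trmx_inj; rewrite trmx0; apply/eqP/negPn/negP => /(ip_neq0 f)/eqP[].
rewrite ip_coordl big1 // => i _.
have /eqP := gram_mulmx v^T i; rewrite xA mxE eq_sym mulf_eq0 invr_eq0.
rewrite (negPf (ip_neq0 f (e_neq0 R i))) orbF mulf_eq0 pnatr_eq0 /=.
by rewrite ipC => /eqP->; rewrite mulr0.
Qed.

(** Along the line x + t e_i through a point x of the ellipsoid, the equation of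
    the ellipsoid is t (t |e_i|^2 - 2 f (d - x) e_i) = 0. *)
Lemma hvecE x : PE f d x -> hvec f d x = A *m (d - x).
Proof.
rewrite /PE /= => PEx; apply/colP => i; rewrite [LHS]mxE.
have ei := ip_neq0 f (e_neq0 R i).
have PEt t : t != 0 -> PE f d (x + t *: e_ i) <-> t = (A *m (d - x)) i 0.
  move=> t0; rewrite gram_mulmx /PE /=.
  have -> : f (x + t *: e_ i) (x + t *: e_ i - 2 *: d) =
      t * (t * f (e_ i) (e_ i) - 2 * f (d - x) (e_ i)).
    rewrite -[RHS](addr0) -PEx !ipBr !ipBl !ipDr !ipDl !ipZr !ipZl.
    by rewrite (ipC f (e_ i) x) (ipC f (e_ i) d); ring.
  split=> [/eqP|->]; last by rewrite divfK // subrr mulr0.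
  rewrite mulf_eq0 (negPf t0) subr_eq0 /= => /eqP tE.
  by rewrite -tE mulfK.
case: xgetP => [t _ [t0 /(PEt t t0)]//|none].
(* If the line is tangent, there is no second point and the chosen value is 0. *)
apply/esym/eqP/negPn/negP => h0; apply: (none _ (conj h0 _)).
exact/(PEt _ h0).
Qed.

(** Seen from the centre d of the ellipsoid, T_i is a simple reflection. *)
Lemma sub_Tmap i (x : PE f d) :
  d - val (Tmap i x) = reflection f (e_ i) (d - val x).
Proof.
rewrite simple_reflection_gram /= hvecE ?opprD ?addrA //.
exact/set_mem/valP.
Qed.

Lemma WPE_word g : WPE g ->
  forall x : PE f d, exists s, d - val (g x) = word_mx f s *m (d - val x).
Proof.
elim=> [i|x|g1 g2 _ IH1 _ IH2 x|g1 g2 _ IH1 _ gK x].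
- by move=> x; exists [:: i]; rewrite sub_Tmap word_mx1 reflection_mxE.
- by exists [::]; rewrite mul1mx.
- have [s sE] := IH2 x; have [t tE] := IH1 (g2 x).
  by exists (t ++ s); rewrite word_mx_cat -mulmxA -sE tE.
- have [s] := IH1 (g2 x); rewrite gK => sE.
  by exists (rev s); rewrite sE mulmxA word_mx_revK mul1mx.
Qed.

Lemma word_WPE s : exists2 g : PE f d -> PE f d, WPE g &
  forall x, d - val (g x) = word_mx f s *m (d - val x).
Proof.
elim: s => [|i s [g Wg gE]].
  by exists id => [|x]; [exact: WPE_id|rewrite mul1mx].
exists (Tmap i \o g) => [|x]; first exact: WPE_comp (WPE_T _ _ i) Wg.
by rewrite sub_Tmap gE /= -mulmxA reflection_mxE.
Qed.

Lemma SD0_words : SD0 f d = [set A *m (word_mx f s *m d) | s in setT].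
Proof.
apply/seteqP; split=> [_ [_ [g Wg <-] <-]|_ [s _ <-]] /=.
  have [s] := WPE_word Wg (origin f d); rewrite subr0 => sE.
  by exists s => //; rewrite -sE hvecE //; apply/set_mem/valP.
have [g Wg gE] := word_WPE s.
exists (val (g (origin f d))); first by exists g.
by rewrite hvecE ?gE ?subr0 //; apply/set_mem/valP.
Qed.
End Ellipsoid.

(** * The bijection *)

Theorem theorem3p6 (R : realType) (n : nat) (G : lieAlgebra R[i])
    (H : {vspace G}) (alpha : 'I_n -> dual H) (A : 'M[R]_n)
    (f : innerProduct R n) :
  semisimple G ->
  cartan_subalgebra H ->
  \dim H = n ->
  simple_roots alpha ->
  cartan_matrix alpha A ->
  (forall i j : 'I_n, 2 * f (e_ i) (e_ j) / f (e_ i) (e_ i) = A i j) ->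
  set_bij (MW alpha f) (SD0 f (delta alpha))
    (fun w : 'M[R]_n => A *m (w *m delta alpha)).
Proof.
move=> _ cartanH _ simple_alpha cartanA A_gram.
have Au := gram_unitmx A_gram.
have D_finite := Delta_finite cartanH cartanA Au.
have D_neq0 := @Delta_neq0 _ _ _ _ alpha.
have D_simple := Delta_simple simple_alpha.
have D_coord := Delta_coord simple_alpha.
have D_refl i x : Delta alpha x -> Delta alpha (reflection f (e_ i) x).
  rewrite (simple_reflection_gram A_gram).
  exact: Delta_reflection cartanH cartanA _ _.
have MW_words : MW alpha f = range (word_mx f).
  apply/seteqP; split=> [w|_ [s _ <-]].
    elim=> [b Db||_ _ _ [s _ <-] _ [t _ <-]|_ _ [s _ <-]].
    - have [s ->] := root_reflection_word D_neq0 D_coord D_refl Db.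
      by exists s.
    - by exists [::].
    - by exists (s ++ t); rewrite ?word_mx_cat.
    - exists (rev s) => //; have sK := word_mx_revK f s.
      have [_ su] := mulmx1_unit sK.
      by rewrite -[LHS]mulmx1 -(mulmxV su) mulmxA sK mul1mx.
  elim: s => [|i s IHs]; first exact: MW_one.
  exact/MW_mul/IHs/MW_refl/D_simple.
have delta_gt0 i : 0 < f (e_ i) (delta alpha).
  rewrite /delta ipZr mulr_gt0 ?invr_gt0 //.
  exact: (ip_simple_root_sum_gt0 D_finite).
rewrite (SD0_words _ A_gram) MW_words; split.
- by move=> _ [s _ <-]; exists s.
- move=> _ _ /set_mem[s _ <-] /set_mem[t _ <-] /(can_inj (mulKmx Au)) st.
  have : word_mx f (rev s ++ t) = 1%:M.
    apply: (dominant_regular_stabilizer D_neq0 D_simple D_coord D_refl delta_gt0).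
    by rewrite word_mx_cat -mulmxA -st mulmxA word_mx_revK mul1mx.
  rewrite word_mx_cat => /(congr1 (mulmx (word_mx f s))).
  by rewrite -{1}(revK s) mulmxA word_mx_revK mul1mx mulmx1.
- by move=> _ [s _ <-]; exists (word_mx f s).
Qed.
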